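(* Let $u=u(x,t)$ be an invertible operator-valued function and let $r=u_xu^{-1}$, i.e. $B(u,r)=0$ with $B(u,r)=ru-u_x$. Let $T=-B_r^{-1}B_u$ be the transformation operator associated with this (mirror) Cole–Hopf transformation, which links the heat equation $u_t=u_{xx}$ to the mirror non-Abelian Burgers equation $r_t=r_{xx}+2r_xr$. Let $\Phi(r)=T\,D\,T^{-1}$ be the recursion operator of the mirror non-Abelian Burgers equation obtained by transporting, via $T$, the trivial recursion operator $D$ of the heat equation. Then $$\Phi(r)=(D-C_r)(D+R_r)(D-C_r)^{-1}.$$
   Context: The unknowns $u(x,t)$ and $r(x,t)$ are smooth functions of real variables $x,t$ with values in the bounded linear endomorphisms of a Banach space, so products are non-commutative. $D=\partial/\partial x$. For operator-valued functions $a,\sigma$: $L_a\sigma=a\sigma$ (left multiplication), $R_a\sigma=\sigma a$ (right multiplication), $C_a\sigma=[a,\sigma]=a\sigma-\sigma a$ (commutator). Products of such linear operators denote composition. The directional derivatives of $B$ are $B_u[V]=\frac{\partial}{\partial\epsilon}\big|_{\epsilon=0}B(u+\epsilon V,r)$ and $B_r[W]=\frac{\partial}{\partial\epsilon}\big|_{\epsilon=0}B(u,r+\epsilon W)$, regarded as linear operators acting on operator-valued functions $V$, $W$. The setting is formal: no particular function space is fixed; the operators act on spaces of operator-valued functions on which all the operations involved are defined and on which $D-C_r$ has the (two-sided) inverse $(D-C_r)^{-1}$, so that $T$ is invertible. *)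

(* Defs.v *)
From HB Require Import structures.
From mathcomp Require Import all_boot all_order all_algebra.
From mathcomp Require Import all_classical all_reals all_analysis.
Set Implicit Arguments.
Unset Strict Implicit.
Unset Printing Implicit Defensive.
Import Order.TTheory GRing.Theory Num.Theory.
Import numFieldNormedType.Exports.
Local Open Scope classical_set_scope.
Local Open Scope ring_scope.

(* The unital normed algebra of bounded linear endomorphisms of a normed
   space X: product is composition, norm is the operator norm.
   The scalars are real, but nothing is lost for a complex Banach space: its
   complex-linear bounded endomorphisms form a real subspace of [bounded_op X]
   (X seen as a real space) with the same product and norm, and the function
   spaces E and F of [admissible] below may be taken inside it. *)
Section BoundedOp.
Context {R : realType} {X : normedModType R}.

Definition bounded_linear (f : X -> X) : Prop :=
  linear f /\ exists M : R, forall x, `|f x| <= M * `|x|.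

Definition bounded_op_pred : {pred X -> X} :=
  fun f => `[< bounded_linear f >].

Record bounded_op := BoundedOp {
  bop_fun :> X -> X ;
  bop_funP : bop_fun \in bounded_op_pred }.

HB.instance Definition _ := [isSub for bop_fun].
HB.instance Definition _ := [Choice of bounded_op by <:].

Lemma bounded_op_linP (f : bounded_op) : bounded_linear f.
Proof. exact/asboolP/(bop_funP f). Qed.

Lemma bounded_op_submod_closed : submod_closed bounded_op_pred.
Proof.
split.
  apply/asboolP; split.
    by move=> a x y; rewrite /= scaler0 addr0.
  by exists 0 => x; rewrite normr0 mul0r.
move=> a f g /asboolP[lf [M fM]] /asboolP[lg [N gN]].
apply/asboolP; split.
  move=> b x y; rewrite !addrfctE !scalrfctE /= lf lg !scalerDr addrACA.
  by rewrite !scalerA (mulrC a b).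
exists (`|a| * M + N) => x; rewrite mulrDl; apply: le_trans (ler_normD _ _) _.
by rewrite lerD// normrZ -mulrA ler_wpM2l.
Qed.

HB.instance Definition _ :=
  GRing.isSubmodClosed.Build R (X -> X) bounded_op_pred bounded_op_submod_closed.
HB.instance Definition _ := [SubChoice_isSubLmodule of bounded_op by <:].

Lemma bounded_op_id_subproof : (id : X -> X) \in bounded_op_pred.
Proof.
apply/asboolP; split => //.
by exists 1 => x; rewrite mul1r.
Qed.
Definition bounded_op_id := BoundedOp bounded_op_id_subproof.

Lemma bounded_op_comp_subproof (f g : bounded_op) :
  (f \o g : X -> X) \in bounded_op_pred.
Proof.
have [lf [M fM]] := bounded_op_linP f; have [lg [N gN]] := bounded_op_linP g.
apply/asboolP; split; first by move=> a x y; rewrite /= lg lf.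
exists (`|M| * N) => x /=; apply: le_trans (fM _) _.
apply: (@le_trans _ _ (`|M| * `|g x|)); first by rewrite ler_wpM2r// ler_norm.
by rewrite -mulrA ler_wpM2l.
Qed.
Definition bounded_op_comp (f g : bounded_op) :=
  BoundedOp (bounded_op_comp_subproof f g).

Lemma bounded_opP (f g : bounded_op) : (forall x, f x = g x) -> f = g.
Proof. by move=> fg; apply/val_inj/funext. Qed.

Lemma bounded_opDE (f g : bounded_op) x : (f + g) x = f x + g x.
Proof. by []. Qed.

Lemma bounded_opZE (a : R) (f : bounded_op) x : (a *: f) x = a *: f x.
Proof. by []. Qed.

Let compA : associative bounded_op_comp.
Proof. by move=> f g h; apply: bounded_opP. Qed.
Let comp1f : left_id bounded_op_id bounded_op_comp.
Proof. by move=> f; apply: bounded_opP. Qed.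
Let compf1 : right_id bounded_op_id bounded_op_comp.
Proof. by move=> f; apply: bounded_opP. Qed.
Let compDl : left_distributive bounded_op_comp +%R.
Proof. by move=> f g h; apply: bounded_opP. Qed.
Let compDr : right_distributive bounded_op_comp +%R.
Proof.
move=> f g h; apply: bounded_opP => x /=.
have [lf _] := bounded_op_linP f.
by have := lf 1 (g x) (h x); rewrite !scale1r.
Qed.

HB.instance Definition _ := GRing.Zmodule_isPzRing.Build bounded_op
  compA comp1f compf1 compDl compDr.

Definition opnorm (f : bounded_op) : R :=
  sup [set `|f x| | x in [set x : X | `|x| <= 1]].

Let opset (f : bounded_op) := [set `|f x| | x in [set x : X | `|x| <= 1]].

Let opset_neq0 f : opset f !=set0.
Proof. by exists `|f 0|, 0 => //=; rewrite normr0. Qed.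

Let opset_ub f : has_ubound (opset f).
Proof.
have [_ [M fM]] := bounded_op_linP f; exists `|M| => _ [x /= x1 <-].
apply: le_trans (fM _) _; apply: (@le_trans _ _ (`|M| * `|x|)).
  by rewrite ler_wpM2r// ler_norm.
by rewrite ler_piMr.
Qed.

Let bop0 (f : bounded_op) : f 0 = 0.
Proof.
have [lf _] := bounded_op_linP f.
by have := lf (-1) 0 0; rewrite !scaleN1r !addNr.
Qed.

Let bopZ (f : bounded_op) a x : f (a *: x) = a *: f x.
Proof.
have [lf _] := bounded_op_linP f.
by have := lf a x 0; rewrite bop0 !addr0.
Qed.

Lemma opnorm_ge0 f : 0 <= opnorm f.
Proof.
apply: (@le_trans _ _ `|f 0|) => //.
by apply: (ub_le_sup (@opset_ub f)); exists 0 => //=; rewrite normr0.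
Qed.

Lemma opnormP (f : bounded_op) x : `|f x| <= opnorm f * `|x|.
Proof.
have [->|x0] := eqVneq x 0; first by rewrite bop0 !normr0 mulr0.
have nx0 : 0 < `|x| by rewrite normr_gt0.
rewrite -ler_pdivrMr// mulrC.
have -> : `|x|^-1 * `|f x| = `|f (`|x|^-1 *: x)|.
  by rewrite bopZ normrZ ger0_norm// invr_ge0.
apply: (ub_le_sup (@opset_ub f)); exists (`|x|^-1 *: x) => //=.
by rewrite normrZ ger0_norm ?invr_ge0// mulVf// gt_eqF.
Qed.

Lemma opnorm_le (f : bounded_op) (M : R) : 0 <= M ->
  (forall x, `|f x| <= M * `|x|) -> opnorm f <= M.
Proof.
move=> M0 fM; apply: ge_sup; first exact: (@opset_neq0 f).
by move=> _ [x /= x1 <-]; apply: le_trans (fM x) _; rewrite ler_piMr.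
Qed.

Let opnormD f g : opnorm (f + g) <= opnorm f + opnorm g.
Proof.
apply: opnorm_le; first by rewrite addr_ge0// opnorm_ge0.
move=> x; rewrite bounded_opDE mulrDl; apply: le_trans (ler_normD _ _) _.
by rewrite lerD// opnormP.
Qed.

Let opnormZ_le a f : opnorm (a *: f) <= `|a| * opnorm f.
Proof.
apply: opnorm_le; first by rewrite mulr_ge0// opnorm_ge0.
by move=> x; rewrite bounded_opZE normrZ -mulrA ler_wpM2l// opnormP.
Qed.

Let opnormZ a f : opnorm (a *: f) = `|a| * opnorm f.
Proof.
apply/eqP; rewrite eq_le opnormZ_le/=.
have [->|a0] := eqVneq a 0; first by rewrite normr0 mul0r opnorm_ge0.
have := opnormZ_le a^-1 (a *: f).
by rewrite scalerA mulVf// scale1r normfV ler_pdivlMl// normr_gt0.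
Qed.

Let opnorm0_eq0 f : opnorm f = 0 -> f = 0.
Proof.
move=> f0; apply: bounded_opP => x; apply/normr0_eq0/eqP.
by rewrite eq_le normr_ge0 andbT; have := opnormP f x; rewrite f0 mul0r.
Qed.

HB.instance Definition _ := Lmodule_isNormed.Build R bounded_op
  opnormD opnormZ opnorm0_eq0.

End BoundedOp.
Arguments bounded_op {R} X.

(* Operator-valued functions of p = (x, t).  The sum, product and scaling of
   such functions are the pointwise ones. *)
Definition opfun (R : realType) (X : normedModType R) : Type :=
  R * R -> bounded_op X.

HB.instance Definition _ (R : realType) (X : normedModType R) :=
  GRing.PzRing.copy (opfun X) (R * R -> bounded_op X).
HB.instance Definition _ (R : realType) (X : normedModType R) :=
  GRing.Lmodule.copy (opfun X) (R * R -> bounded_op X).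

Section Operators.
Context {R : realType} {X : normedModType R}.
Implicit Types (f a u r V W : opfun X) (E F A : set (opfun X)).

Definition dx : R * R := (1, 0).
Definition dt : R * R := (0, 1).

(* C^n, by recursion on the first-order partial derivatives; f is smooth when
   all its iterated partial derivatives exist and are jointly continuous for
   the operator norm. *)
Fixpoint Cn (n : nat) f : Prop :=
  if n is n'.+1 then
    [/\ continuous (f : R * R -> bounded_op X),
        forall p, derivable f p dx /\ derivable f p dt,
        Cn n' (fun p => 'D_dx f p) & Cn n' (fun p => 'D_dt f p)]
  else continuous (f : R * R -> bounded_op X).

Definition smooth f : Prop := forall n, Cn n f.

Definition D f : opfun X := fun p => 'D_dx f p.
Definition Lmul a : opfun X -> opfun X := fun f => a * f.
Definition Rmul a : opfun X -> opfun X := fun f => f * a.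
Definition Comm a : opfun X -> opfun X := fun f => a * f - f * a.

(* The inverse of an operator P : A -> A'; meaningful on the image of A when
   P is injective on A. *)
Definition opinv A (P : opfun X -> opfun X) : opfun X -> opfun X :=
  'pinv_(fun=> 0) A P.

Section TransformationOperator.
Variable B : opfun X -> opfun X -> opfun X.

Definition dirderiv1 u r V : opfun X :=
  fun p => derive1 (fun e : R => B (u + e *: V) r p) 0.
Definition dirderiv2 u r W : opfun X :=
  fun p => derive1 (fun e : R => B u (r + e *: W) p) 0.

(* - B_r^{-1} B_u, where B_r has domain F *)
Definition transformation F u r : opfun X -> opfun X :=
  - (opinv F (dirderiv2 u r) \o dirderiv1 u r).

(* T P T^{-1} for an operator P on E *)
Definition transport E F u r (P : opfun X -> opfun X) : opfun X -> opfun X :=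
  transformation F u r \o P \o opinv E (transformation F u r).

End TransformationOperator.

Definition mirror_cole_hopf u r : opfun X := r * u - D u.

(* E is a space of variations of u and F a space of variations of r on which
   the operations involved are defined; v is the inverse of u. *)
Record admissible (u v r : opfun X) (E F : set (opfun X)) : Prop := {
  admissible_E_submod : submod_closed (mem E) ;
  admissible_F_submod : submod_closed (mem F) ;
  admissible_E_derivable : forall V, E V -> forall p, derivable V p dx ;
  admissible_F_derivable : forall W, F W -> forall p, derivable W p dx ;
  admissible_E_D : set_fun E E D ;
  admissible_F_D : set_fun F F D ;
  admissible_E_Lmul : set_fun E E (Lmul r) ;
  admissible_F_Lmul : set_fun F F (Lmul r) ;
  admissible_F_Rmul : set_fun F F (Rmul r) ;
  admissible_Rmul_u : set_fun F E (Rmul u) ;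
  admissible_Rmul_v : set_fun E F (Rmul v) ;
  admissible_bij : set_bij F F (D - Comm r) }.

End Operators.

(* Main.v *)
Require Import Defs.
From HB Require Import structures.
From mathcomp Require Import all_boot all_order all_algebra.
From mathcomp Require Import all_classical all_reals all_analysis.
Set Implicit Arguments.
Unset Strict Implicit.
Unset Printing Implicit Defensive.
Import Order.TTheory GRing.Theory Num.Theory.
Import numFieldNormedType.Exports.
Local Open Scope classical_set_scope.
Local Open Scope ring_scope.

(** With [r = u_x v], where [v] is the inverse of [u], the function [B] is
    affine in each of its arguments, so its directional derivatives are
    [B_r W = W u] and [B_u V = r V - V_x].  Right multiplication by [u] is a
    bijection from [F] onto [E], with inverse right multiplication by [v];
    hence [B_r] is invertible and [T V = (V_x - r V) v].

    Everything follows from reading [T] through the substitution [V = W u].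
    Since [u_x = r u], the Leibniz rule gives
    [(W u)_x = W_x u + W u_x = ((D + R_r) W) u], that is,
      [D o R_u = R_u o (D + R_r)],
    and therefore also
      [T o R_u = (D + R_r) - L_r = D - C_r].
    The second identity shows that [T] is a bijection, being the composite of
    [R_v] and [D - C_r], and that [T^-1 = R_u o (D - C_r)^-1].  Conjugating,
      [T D T^-1 = T D R_u (D - C_r)^-1 = T R_u (D + R_r) (D - C_r)^-1
                = (D - C_r) (D + R_r) (D - C_r)^-1].

    The analytic content is the Leibniz rule for the composition of bounded
    operators ([derive_mulop]), which rests on the submultiplicativity of the
    operator norm ([ler_opnormM]); the two intertwining identities are
    [D_Rmul_cole_hopf] and [transformation_Rmul]. *)

(** * Calculus in the algebra of bounded operators *)

Section BoundedOpCalculus.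
Context {R : realType} {X : normedModType R}.
Implicit Types (a b : bounded_op X) (f g : opfun X).

Lemma ler_opnormM a b : `|a * b| <= `|a| * `|b|.
Proof.
apply: opnorm_le => [|x]; first by rewrite mulr_ge0 ?opnorm_ge0.
apply: le_trans (opnormP a (b x)) _.
by rewrite -mulrA ler_wpM2l ?opnorm_ge0 ?opnormP.
Qed.

Lemma mulop_scalel (k : R) a b : (k *: a) * b = k *: (a * b).
Proof. exact: bounded_opP. Qed.

Lemma mulop_scaler (k : R) a b : a * (k *: b) = k *: (a * b).
Proof.
apply: bounded_opP => x; have [lin_a _] := bounded_op_linP a.
have a0 : a 0 = 0 by have := lin_a (-1) 0 0; rewrite !scaleN1r !addNr.
by have := lin_a k (b x) 0; rewrite a0 !addr0.
Qed.

Lemma cvg_mulop {T : Type} {G : set_system T} {FG : Filter G}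
    (f g : T -> bounded_op X) a b :
  f @ G --> a -> g @ G --> b -> f t * g t @[t --> G] --> a * b.
Proof.
move=> fa gb; apply/subr_cvg0/norm_cvg0P.
pose bound t : R := `|f t| * `|g t - b| + `|f t - a| * `|b|.
have bound0 : bound t @[t --> G] --> (0 : R).
  rewrite -[X in _ --> X](addr0 0) -[X in _ --> X + _](mulr0 `|a|).
  rewrite -[X in _ --> _ + X](mul0r `|b|).
  by apply: cvgD; apply: cvgM; [exact: cvg_norm
    |exact/norm_cvg0P/subr_cvg0|exact/norm_cvg0P/subr_cvg0|exact: cvg_cst].
apply: (@squeeze_cvgr _ _ _ _ (cst 0) bound); [|exact: cvg_cst|exact: bound0].
apply: nearW => t.
rewrite normr_ge0 /=.
have -> : f t * g t - a * b = f t * (g t - b) + (f t - a) * b.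
  by rewrite mulrBr mulrBl addrA subrK.
by apply: le_trans (ler_normD _ _) _; rewrite lerD ?ler_opnormM.
Qed.

Lemma derivable_cvg f (p w : R * R) : derivable f p w ->
  f (h *: w + p) @[h --> (0 : R)^'] --> f p.
Proof.
move=> df; suff : {for 0, continuous (fun h : R => f (h *: w + p))}.
  by move=> /continuous_withinNx; rewrite scale0r add0r.
exact/differentiable_continuous/derivable1_diffP/(derivable1P _ _ _).1.
Qed.

(** The increment of [f * g] splits as
    [(f(p+hw) - f(p)) g(p+hw) + f(p) (g(p+hw) - g(p))]; the factor [g(p+hw)] is
    harmless because derivability in the direction [w] gives continuity along
    [w]. *)
Lemma derive_mulop f g (p w : R * R) :
  derivable f p w -> derivable g p w ->
  'D_w (f * g) p = 'D_w f p * g p + f p * 'D_w g p.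
Proof.
move=> df dg; apply: cvg_lim => //.
pose quot (k : opfun X) (h : R) := h^-1 *: (k (h *: w + p) - k p).
rewrite [X in X @ _](_ : _ =
    fun h => quot f h * g (h *: w + p) + f p * quot g h); last first.
  apply/funext => h; rewrite mulop_scalel mulop_scaler -scalerDr /=.
  by rewrite mulrBl mulrBr addrA subrK.
by apply: cvgD; apply: cvg_mulop; [|exact: derivable_cvg|exact: cvg_cst|].
Qed.

Lemma D_mul f g : (forall p, derivable f p dx) ->
  (forall p, derivable g p dx) -> D (f * g) = D f * g + f * D g.
Proof. by move=> df dg; apply/funext => p; rewrite /D derive_mulop. Qed.

Lemma derive1_affine (V : normedModType R) (y z : V) :
  derive1 (fun e : R => y + e *: z) 0 = z.
Proof.
apply: cvg_lim => //; apply: cvg_near_cst; near=> h.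
have h0 : h != 0 by near: h; exact: nbhs_dnbhs_neq.
by rewrite addr0 scale0r addr0 addrC addKr scalerA mulVf// scale1r.
Unshelve. all: end_near. Qed.

End BoundedOpCalculus.

(** * The directional derivatives of the mirror Cole-Hopf map *)

Section ColeHopf.
Context {R : realType} {X : normedModType R}.
Implicit Types (u v r V W : opfun X) (E F : set (opfun X)).

Lemma smooth_derivable_dx u : smooth u -> forall p, derivable u p dx.
Proof. by move=> /(_ 1%N)[_ du _ _] p; have [] := du p. Qed.

Lemma mulfun_scalel (k : R) V W : (k *: V) * W = k *: (V * W).
Proof. by apply/funext => p; exact: mulop_scalel. Qed.

Lemma mulfun_scaler (k : R) V W : V * (k *: W) = k *: (V * W).
Proof. by apply/funext => p; exact: mulop_scaler. Qed.

Lemma dirderiv2_cole_hopf u r W :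
  dirderiv2 (@mirror_cole_hopf R X) u r W = W * u.
Proof.
apply/funext => p; rewrite /dirderiv2 /mirror_cole_hopf.
rewrite -[RHS](derive1_affine ((r * u - D u) p)); congr (derive1 _ 0).
apply/funext => e.
by rewrite mulrDl mulfun_scalel addrAC.
Qed.

Lemma dirderiv1_cole_hopf u r V : (forall p, derivable u p dx) ->
  (forall p, derivable V p dx) ->
  dirderiv1 (@mirror_cole_hopf R X) u r V = r * V - D V.
Proof.
move=> du dV; apply/funext => p; rewrite /dirderiv1 /mirror_cole_hopf.
rewrite -[RHS](derive1_affine ((r * u - D u) p)); congr (derive1 _ 0).
apply/funext => e.
have -> : D (u + e *: V) = D u + e *: D V.
  apply/funext => q; rewrite /D deriveD//; last exact: derivableZ.
  by congr (_ + _); exact: deriveZ.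
by rewrite mulrDr mulfun_scaler opprD addrACA -scalerBr.
Qed.

End ColeHopf.

(** * The transformation operator *)

Lemma set_bij_can {S S' : Type} (A : set S) (B : set S') (f : S -> S')
    (g : S' -> S) : set_fun A B f -> set_fun B A g ->
  {in A, cancel f g} -> {in B, cancel g f} -> set_bij A B f.
Proof.
move=> fAB gBA fK gK; split => //; first exact: can_in_inj fK.
by move=> y By; exists (g y); [exact: gBA|rewrite gK ?inE].
Qed.

Section Transformation.
Context {R : realType} {X : normedModType R}.
Variables (u v r : opfun X) (E F : set (opfun X)).
Hypothesis du : forall p, derivable u p dx.
Hypotheses (uv1 : u * v = 1) (vu1 : v * u = 1).
Hypotheses (r_def : r = D u * v) (EF : admissible u v r E F).

Let B := @mirror_cole_hopf R X.
Let T := transformation B F u r.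

Lemma cole_hopf_linear : D u = r * u.
Proof. by rewrite r_def -mulrA vu1 mulr1. Qed.

Lemma Rmul_bij : set_bij F E (Rmul u).
Proof.
apply: (@set_bij_can _ _ _ _ _ (Rmul v)).
- exact: admissible_Rmul_u EF.
- exact: admissible_Rmul_v EF.
- by move=> W _; rewrite /Rmul -mulrA uv1 mulr1.
- by move=> V _; rewrite /Rmul -mulrA vu1 mulr1.
Qed.

Lemma dirderiv2_cole_hopf_bij : set_bij F E (dirderiv2 B u r).
Proof.
by apply: eq_set_bijLR Rmul_bij => W _; exact: dirderiv2_cole_hopf.
Qed.

(** Since [u_x = r u], differentiation after right multiplication by [u] is
    right multiplication by [u] after [D + R_r]: the operator [D] of the linear
    heat equation is conjugate to [D + R_r]. *)
Lemma D_Rmul_cole_hopf W : F W -> D (Rmul u W) = Rmul u ((D + Rmul r) W).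
Proof.
move=> FW; rewrite /Rmul D_mul//; last exact: admissible_F_derivable EF _ FW.
by rewrite cole_hopf_linear mulrA -mulrDl.
Qed.

(** The inverse of [B_r] is right multiplication by [v]: it is applied to
    [B_u V = r V - V_x], which lies in [E]. *)
Lemma transformationE V : E V -> T V = Rmul v (D V - r * V).
Proof.
move=> EV; have dV := admissible_E_derivable EF EV.
have EV' : E (r * V - D V).
  have [_ linE] := admissible_E_submod EF.
  have /[!inE] := linE (-1) (D V) (r * V); rewrite scaleN1r addrC; apply.
    exact: admissible_E_D EF _ EV.
  exact: admissible_E_Lmul EF _ EV.
rewrite [T V]/(- opinv F (dirderiv2 B u r) (dirderiv1 B u r V)).
rewrite dirderiv1_cole_hopf//.
set Z := r * V - D V in EV' *.
have -> : D V - r * V = - Z by rewrite opprB.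
have -> : opinv F (dirderiv2 B u r) Z = Rmul v Z; last by rewrite /Rmul mulNr.
rewrite -[X in opinv _ _ X]mulr1 -vu1 mulrA -(dirderiv2_cole_hopf u r).
have [_ inj _] := dirderiv2_cole_hopf_bij.
by apply: pinvKV => //; rewrite inE; exact: admissible_Rmul_v EF _ EV'.
Qed.

(** In the variable [W = V v] the left multiplication by [r] in [T] meets the
    right multiplication by [r] coming from [u_x = r u], and the two combine
    into the commutator. *)
Lemma transformation_Rmul W : F W -> T (Rmul u W) = (D - Comm r) W.
Proof.
move=> FW; rewrite transformationE; last exact: admissible_Rmul_u EF _ FW.
rewrite D_Rmul_cole_hopf// /Rmul mulrA -mulrBl -mulrA uv1 mulr1.
have -> : (D - Comm r) W = D W - (r * W - W * r) by [].
by rewrite opprB addrA.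
Qed.

(** [T] is the composite of [R_v], from [E] onto [F], and of the bijection
    [D - C_r] of [F]. *)
Lemma transformation_bij : set_bij E F T.
Proof.
have Rv_bij : set_bij E F (Rmul v).
  apply: (@set_bij_can _ _ _ _ _ (Rmul u)).
  - exact: admissible_Rmul_v EF.
  - exact: admissible_Rmul_u EF.
  - by move=> V _; rewrite /Rmul -mulrA vu1 mulr1.
  - by move=> W _; rewrite /Rmul -mulrA uv1 mulr1.
apply: eq_set_bijLR (set_bij_comp Rv_bij (admissible_bij EF)).
move=> V /[!inE] EV /=; rewrite -transformation_Rmul.
  by rewrite /Rmul -mulrA vu1 mulr1.
exact: admissible_Rmul_v EF _ EV.
Qed.

(** On [W = (D - C_r) Y] the two inverses evaluate explicitly: [Y] is the
    preimage of [W] under [D - C_r], and [Y u] its preimage under [T]. *)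
Lemma transport_D_cole_hopf :
  {in F, transport B E F u r D =1
    (D - Comm r) \o (D + Rmul r) \o opinv F (D - Comm r)}.
Proof.
move=> W; rewrite inE => FW.
have [_ injC surjC] := admissible_bij EF; have [Y FY <-{W FW}] := surjC W FW.
have [_ injT _] := transformation_bij.
have FY' : F ((D + Rmul r) Y).
  have [_ linF] := admissible_F_submod EF.
  have /[!inE] := linF 1 (D Y) (Y * r); rewrite scale1r; apply.
    exact: admissible_F_D EF _ FY.
  exact: admissible_F_Rmul EF _ FY.
rewrite /transport /= -/T /opinv (pinvKV _ injC) ?inE// -transformation_Rmul//.
rewrite (pinvKV _ injT) ?inE; last exact: admissible_Rmul_u EF _ FY.
by rewrite D_Rmul_cole_hopf// transformation_Rmul.
Qed.

End Transformation.

Theorem proposition1 (R : realType) (X : completeNormedModType R)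
    (u v r : opfun X) (E F : set (opfun X))
    (u_smooth : smooth u)
    (uv1 : u * v = 1) (vu1 : v * u = 1)
    (r_def : r = D u * v)
    (EF : admissible u v r E F) :
  let B := @mirror_cole_hopf R X in
  let T := transformation B F u r in
  let Phi := transport B E F u r D in
  [/\ B u r = 0,
      set_bij F E (dirderiv2 B u r),
      set_bij E F T &
      {in F, Phi =1
        (D - Comm r) \o (D + Rmul r) \o opinv F (D - Comm r)}].
Proof.
have du := smooth_derivable_dx u_smooth.
split.
- by rewrite /mirror_cole_hopf (cole_hopf_linear vu1 r_def) subrr.
- exact: dirderiv2_cole_hopf_bij uv1 vu1 EF.
- exact: transformation_bij du uv1 vu1 r_def EF.
- exact: transport_D_cole_hopf du uv1 vu1 r_def EF.
Qed.
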